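(* Let $\Phi^c_\Theta: X\to Z$ be a component-wise convex neural network of depth $L$ (of the form described in the context). Let $D'\ge 1$, let $f_d:X\to\mathbb{R}$ and $g_d:Z\to\mathbb{R}$ be real-valued functions for $d=1,\dots,D'$, and define $\Phi^{uc}_\Theta:X\to Z'=(\mathbb{R}^{D'},\|\cdot\|_{Z'})$ by $$\Phi^{uc}_\Theta(\boldsymbol{x})=\big(f_1(\boldsymbol{x})+g_1(\Phi^c_\Theta(\boldsymbol{x})),\dots,f_{D'}(\boldsymbol{x})+g_{D'}(\Phi^c_\Theta(\boldsymbol{x}))\big)^T.$$ Suppose that for every $d=1,\dots,D'$: (C3) $f_d$ is continuous and uniformly convex; (C4) $g_d$ is continuous, convex and monotone nondecreasing on the image $\Phi^c_\Theta(X)\subseteq Z$. Then $\Phi^{uc}_\Theta$ is component-wise uniformly convex, i.e. each of its components is a uniformly convex function on $X$.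
   Context: $X=(\mathbb{R}^N,\|\cdot\|_X)$, $Z=(\mathbb{R}^D,\|\cdot\|_Z)$ and $Z'=(\mathbb{R}^{D'},\|\cdot\|_{Z'})$ are finite-dimensional normed spaces. For vectors of the same dimension, $\boldsymbol{x}\le\hat{\boldsymbol{x}}$ means $x_i\le\hat x_i$ for all $i$; a real-valued function $g$ is monotone nondecreasing (on a set) if $\boldsymbol{x}\le\hat{\boldsymbol{x}}$ implies $g(\boldsymbol{x})\le g(\hat{\boldsymbol{x}})$ (for points of that set). The concatenation of vectors is $C(\boldsymbol{z},\boldsymbol{x})=(z_1,\dots,z_D,x_1,\dots,x_N)^T$. A function $\mathcal{R}:\operatorname{dom}(\mathcal{R})\subseteq X\to(-\infty,+\infty]$ is uniformly convex if there is a map $h:[0,+\infty)\to[0,+\infty]$ with $h(s)=0$ if and only if $s=0$, such that for all $t\in[0,1]$ and all $\boldsymbol{x},\hat{\boldsymbol{x}}\in\operatorname{dom}(\mathcal{R})$, $$\mathcal{R}(t\boldsymbol{x}+(1-t)\hat{\boldsymbol{x}})+t(1-t)h(\|\boldsymbol{x}-\hat{\boldsymbol{x}}\|_X)\le t\mathcal{R}(\boldsymbol{x})+(1-t)\mathcal{R}(\hat{\boldsymbol{x}}).$$ Neural network of depth $L$: Fix finite-dimensional normed spaces $Z^1=X$, $Z^k=(\mathbb{R}^{D_k},\|\cdot\|_{Z_k})$ for $k=2,\dots,L+1$, with $Z^{L+1}=Z$. For $k=1,\dots,L$ fix a vector $\boldsymbol{b}^k$, matrices $W^k$ and $A^{k,j_k}$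 with an index $j_k\in\{1,\dots,k\}$, and a possibly nonlinear map $\sigma^k:\mathbb{R}^{m_k}\to\mathbb{R}^{D_{k+1}}$, all of compatible dimensions. The network $\Phi_\Theta:X\to Z$ with parameters $\Theta=\{\boldsymbol{b}^k;A^{k,j_k};W^k\}_{k=1}^L$ is defined by $\boldsymbol{z}^1=\boldsymbol{x}$, and for $k=1,\dots,L$, $$\boldsymbol{z}^{k+1}=\sigma^k\big(\hat{\boldsymbol{b}}^k+W^k\hat{\boldsymbol{z}}^k\big),\qquad \hat{\boldsymbol{b}}^k=\boldsymbol{b}^k+A^{k,j_k}\boldsymbol{z}^{j_k},$$ where for each $k$, either $\hat{\boldsymbol{z}}^k=\boldsymbol{z}^k$, or $\hat{\boldsymbol{z}}^k=C(\boldsymbol{z}^{i_k},\boldsymbol{z}^k)$ for a fixed $i_k\in\{1,\dots,k\}$; finally $\Phi_\Theta(\boldsymbol{x})=\boldsymbol{z}^{L+1}$. The network is component-wise convex if each of its $D$ components is a convex function on $X$.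
   Formalization: In (C4), convexity and monotonicity of g_d are assumed on the convex hull of the image (the image itself when it is convex); on the image alone the claim fails, e.g. Φ(x)=(x,|x|), g(u,v)=2u−v, f(x)=x². *)

(* Defs.v *)
From HB Require Import structures.
From mathcomp Require Import all_boot all_order all_algebra.
From mathcomp Require Import all_classical all_reals all_analysis.

Set Implicit Arguments.
Unset Strict Implicit.
Unset Printing Implicit Defensive.

Import Order.TTheory GRing.Theory Num.Theory.
Import numFieldNormedType.Exports.

Local Open Scope classical_set_scope.
Local Open Scope ring_scope.

(* An arbitrary norm on M, and the normed space (M, nu): the same carrier as M,
   with the topology induced by nu instead of the sup-norm topology that the
   library puts on matrices. *)
Record norm_on (R : realType) (M : lmodType R) := NormOn {
  norm_fun :> M -> R;
  norm_triangle : forall x y, norm_fun (x + y) <= norm_fun x + norm_fun y;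
  norm_scale : forall (a : R) x, norm_fun (a *: x) = `|a| * norm_fun x;
  norm_definite : forall x, norm_fun x = 0 -> x = 0
}.

Definition normed_space (R : realType) (M : lmodType R) (nu : norm_on M) : Type
  := M.

HB.instance Definition _ (R : realType) (M : lmodType R) (nu : norm_on M) :=
  GRing.Lmodule.on (normed_space nu).

HB.instance Definition _ (R : realType) (M : lmodType R) (nu : norm_on M) :=
  Lmodule_isNormed.Build R (normed_space nu)
    (norm_triangle nu) (norm_scale nu) (@norm_definite _ _ nu).

Definition cv_le (R : realType) (n : nat) (x y : 'cV[R]_n) : Prop :=
  forall i, x i 0 <= y i 0.

Definition nondecreasing_on (R : realType) (n : nat) (A : set 'cV[R]_n)
    (g : 'cV[R]_n -> R) : Prop :=
  forall x y, A x -> A y -> cv_le x y -> g x <= g y.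

Definition componentwise_convex (R : realType) (n m : nat)
    (F : 'cV[R]_n -> 'cV[R]_m) : Prop :=
  forall d : 'I_m, convex_function setT (fun x : 'cV[R]_n => F x d 0).

(* "Convex and nondecreasing on the image A" is read on the convex hull of A,
   which is A itself as soon as A is convex.  The comparison needed is between
   a point of A and a convex combination of points of A, and monotonicity on
   the points of A alone does not give it: for Phi x = (x, |x|),
   g (u, v) = 2u - v and f x = x^2, g is linear and nondecreasing on the image
   of Phi, but f x + g (Phi x) = x^2 + 2x - |x| is not convex. *)
Definition convex_hull (R : realType) (M : lmodType R) (A : set M) : set M :=
  smallest (@convex_set R M) A.

Lemma convex_hull_id (R : realType) (M : lmodType R) (A : set M) :
  convex_set A -> convex_hull A = A.
Proof. exact: smallest_id. Qed.

(* In the product with h the convention is 0 * +oo = 0, so the endpoints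
   t = 0 and t = 1 impose nothing.  Only the values of h on [0, +oo[ matter. *)
Definition uniformly_convex (R : realType) (V : normedModType R)
    (dom : set V) (F : V -> \bar R) : Prop :=
  [/\ convex_set dom,
      forall x, dom x -> F x <> -oo%E
    & exists h : R -> \bar R,
      [/\ forall s, 0 <= s -> (0 <= h s)%E,
          forall s, 0 <= s -> (h s = 0%E <-> s = 0)
        & forall (t : R) (x y : V), 0 <= t <= 1 -> dom x -> dom y ->
          (F (t *: x + (1 - t) *: y)%R + (t * (1 - t))%:E * h `|(x - y)%R|%R
             <= t%:E * F x + (1 - t)%:E * F y)%E]].

(* Layers are numbered from 0: with z^1 = x stored as [z 0], layer [k] computes
   [z k.+1] from [z 0], ..., [z k].  [concat] is [None] when the matrix W^k
   acts on z^k, and [Some i] when it acts on the concatenation C(z^i, z^k). *)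
Definition input_dim (dim : nat -> nat) (k : nat) (concat : option 'I_k.+1)
    : nat :=
  if concat is Some i then (dim i + dim k)%N else dim k.

Record layer (R : realType) (dim : nat -> nat) (k : nat) := Layer {
  width : nat;
  bias : 'cV[R]_width;
  skip_idx : 'I_k.+1;
  skip_weight : 'M[R]_(width, dim skip_idx);
  concat : option 'I_k.+1;
  weight : 'M[R]_(width, input_dim dim concat);
  activation : 'cV[R]_width -> 'cV[R]_(dim k.+1)
}.

Arguments activation [R dim k] l _ : rename.

Definition layer_input (R : realType) (dim : nat -> nat) (k : nat)
    (z : forall j, 'cV[R]_(dim j)) (c : option 'I_k.+1)
    : 'cV[R]_(input_dim dim c) :=
  match c return 'cV[R]_(input_dim dim c) with
  | Some i => col_mx (z i) (z k)
  | None => z k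
  end.

Definition layer_output (R : realType) (dim : nat -> nat) (k : nat)
    (l : layer R dim k) (z : forall j, 'cV[R]_(dim j)) : 'cV[R]_(dim k.+1) :=
  activation l ((bias l + skip_weight l *m z (skip_idx l))
                + weight l *m layer_input z (concat l)).

(* [states net x k] holds the states [z 0], ..., [z k] and is 0 after that. *)
Fixpoint states (R : realType) (dim : nat -> nat)
    (net : forall k, layer R dim k) (x : 'cV[R]_(dim 0%N)) (k : nat)
    : forall j, 'cV[R]_(dim j) :=
  if k is k'.+1 then
    let z := states net x k' in @dfwith nat _ z k'.+1 (layer_output (net k') z)
  else @dfwith nat _ (fun j => 0 : 'cV[R]_(dim j)) 0%N x.

(* The network of depth L; it reads only the layers [net k] with k < L. *)
Definition network (R : realType) (dim : nat -> nat)
    (net : forall k, layer R dim k) (L : nat) (x : 'cV[R]_(dim 0%N))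
    : 'cV[R]_(dim L) :=
  states net x L L.

Definition uc_network (R : realType) (N D D' : nat)
    (f : 'I_D' -> 'cV[R]_N -> R) (g : 'I_D' -> 'cV[R]_D -> R)
    (Phi : 'cV[R]_N -> 'cV[R]_D) (x : 'cV[R]_N) : 'cV[R]_D' :=
  \col_d (f d x + g d (Phi x)).

(* Main.v *)
Require Import Defs.
From mathcomp Require Import all_boot all_order all_algebra.
From mathcomp Require Import all_classical all_reals all_analysis.

Set Implicit Arguments.
Unset Strict Implicit.
Unset Printing Implicit Defensive.

Import Order.TTheory GRing.Theory Num.Theory.
Import numFieldNormedType.Exports.

Local Open Scope classical_set_scope.
Local Open Scope ring_scope.

(** Each component is [f d] plus [g d \o Phi]. A nondecreasing convex function of convex components
    is convex ([convex_function_comp]), and adding a convex function to a uniformly convex one keeps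
    it uniformly convex with the same modulus ([uniformly_convexD]). *)

Lemma convex_hull_convex (R : realType) (M : lmodType R) (A : set M) :
  convex_set (convex_hull A).
Proof.
move=> x y t /set_mem hx /set_mem hy; apply/mem_set => C [convC AC].
by apply/set_mem/convC; apply/mem_set; [apply: hx | apply: hy].
Qed.

(** With p the convex combination of x and y, and q that of [F x] and [F y], convexity of the
    components gives F p <= q coordinatewise, so g (F p) <= g q by monotonicity; convexity of [g]
    then bounds g q. *)
Lemma convex_function_comp (R : realType) (M : lmodType R) (m : nat)
    (F : M -> 'cV[R]_m) (g : 'cV[R]_m -> R) :
  (forall i, convex_function setT (fun x => F x i 0)) ->
  convex_function (convex_hull (range F)) g ->
  nondecreasing_on (convex_hull (range F)) g ->
  convex_function setT (g \o F).
Proof.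
move=> convF convg monog t x y _ _ /=.
have hullF z : convex_hull (range F) (F z) by apply: sub_gen_smallest; exists z.
have hullFxy := @convex_hull_convex R 'cV[R]_m (range F) (F x) (F y) t
  (mem_set (hullF x)) (mem_set (hullF y)).
apply: le_trans (convg t (F x) (F y) (mem_set (hullF x)) (mem_set (hullF y))).
(* The combination of [F x] and [F y] need not be a value of [F]; it is only known to lie in the
   hull, which is where monotonicity is assumed. *)
apply: monog => [||i]; [exact: hullF | exact/set_mem |].
apply: le_trans (convF i t x y (in_setT _) (in_setT _)) _.
by rewrite !mxE.
Qed.

Lemma uniformly_convexD (R : realType) (V : normedModType R) (f k : V -> R) :
  uniformly_convex setT (EFin \o f) -> convex_function setT k ->
  uniformly_convex setT (fun x => (f x + k x)%:E).
Proof.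
move=> [convT _ [h [h_ge0 h_eq0 convf]]] convk; split=> //.
exists h; split=> // t x y t01 _ _.
have [t0 t1] := andP t01.
have {}convk := convk (Itv01 t0 t1) x y (in_setT _) (in_setT _).
(* Group the modulus term with [f] and separate the [f] and [k] parts on the right. [h] may be
   [+oo], so this is done in the extended reals; only the [k] part returns to [R]. *)
rewrite !EFinD addeAC !muleDr // addeACA.
apply: leeD; first exact: convf.
by rewrite -!EFinM -EFinD lee_fin.
Qed.

Theorem theorem3p2 (R : realType) (L : nat) (dim : nat -> nat)
    (nrm : forall k : nat, norm_on 'cV[R]_(dim k))
    (net : forall k : nat, layer R dim k)
    (Phi : normed_space (nrm 0%N) -> normed_space (nrm L))
    (hPhi : Phi = network net L)
    (hPhiconv : componentwise_convex Phi)
    (D' : nat) (hD' : (1 <= D')%N) (nrm' : norm_on 'cV[R]_D')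
    (f : 'I_D' -> normed_space (nrm 0%N) -> R)
    (g : 'I_D' -> normed_space (nrm L) -> R)
    (hf : forall d : 'I_D',
      continuous (f d) /\ uniformly_convex setT (EFin \o f d))
    (hg : forall d : 'I_D',
      [/\ {within range Phi, continuous (g d)},
          convex_function (convex_hull (range Phi)) (g d)
        & nondecreasing_on (convex_hull (range Phi)) (g d)])
    (Phiuc : normed_space (nrm 0%N) -> normed_space nrm')
    (hPhiuc : Phiuc = uc_network f g Phi) :
  forall d : 'I_D',
    uniformly_convex (setT : set (normed_space (nrm 0%N)))
      (fun x => (Phiuc x d 0)%:E).
Proof.
move=> d; rewrite hPhiuc.
have -> : (fun x => (uc_network f g Phi x d 0)%:E)
    = (fun x => (f d x + (g d \o Phi) x)%:E).
  by apply/funext => x; rewrite mxE.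
have [_ convg monog] := hg d.
apply: uniformly_convexD; first exact: (hf d).2.
exact: (@convex_function_comp R (normed_space (nrm 0%N)) (dim L) Phi (g d)).
Qed.
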